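(* Let $\mu=(\mu_I)_{I\in\mathcal{D}^4}$ be a balanced non-negative sequence, and assume that $$\sup_{I\in\mathcal{D}^4}\|\tilde k^{\mathrm{dy}}_I\|^2_{\ell^2_\mu}\leqslant I(\mu)$$ for a finite constant $I(\mu)$, where $\tilde k^{\mathrm{dy}}_I$ are the normalized reproducing kernels of $H^2_{\mathrm{dy}}$. Then there is the embedding from $H^2_{\mathrm{dy}}$ to $\ell^2(\mu)$: for all $f=u+iv\in H^2_{\mathrm{dy}}$, $$\sum_{I\in\mathcal{D}^4}\mu_I\,(u_I^2+v_I^2)\leqslant 3e\,I(\mu)\,\|f\|^2_{H^2_{\mathrm{dy}}} .$$
   Context: Let $I_0=[0,1)$ and let $\mathcal{D}^4=\mathcal{D}^4(I_0)=\{[n4^{-k},(n+1)4^{-k}) : k\in\mathbb{N}_0,\ 0\leqslant n\leqslant 4^k-1\}$ be the 4-adic intervals. For a dyadic interval $K\subseteq I_0$ write $\mathcal{D}^4(K)=\{J\in\mathcal{D}^4: J\subseteq K\}$. For an interval $I$ write $I_-$ and $I_+$ for its left and right halves. For $I\in\mathcal{D}^4$ set $I^y=I_-$ and $I^x=I_+$, and let $I^\star_-$, $I^\star_+$ be the left and right halves of $I^\star$, $\star\in\{x,y\}$; these are the four 4-adic children of $I$, each of length $|I|/4$. A real family $u=(u_I)_{I\in\mathcal{D}^4}$ is a sliced dyadic martingale if for all $I\in\mathcal{D}^4$ $$u_I=\frac{u_{I^x_+}+u_{I^x_-}}2=\frac{u_{I^y_+}+u_{I^y_-}}2 .$$ Its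 increments are $\Delta^\star u_I=\frac12(u_{I^\star_+}-u_{I^\star_-})$, $\star\in\{x,y\}$. If it is $L^2$ integrable, i.e. $\sup_n\sum_{I\in\mathcal{D}^4,|I|=4^{-n}}|I|u_I^2<\infty$, then it is identified with its $L^2$ limit $u\in L^2(I_0)$, so that $u_I=\langle u\rangle_I$ is the average of $u$ over $I$. The dyadic Hardy space $H^2_{\mathrm{dy}}$ consists of $f=u+iv$ with $u,v$ real-valued $L^2$ integrable sliced dyadic martingales satisfying the dyadic Cauchy–Riemann equations $\Delta^x u_I=\Delta^y v_I$, $\Delta^y u_I=-\Delta^x v_I$ for all $I\in\mathcal{D}^4$. It is a Hilbert space with inner product $\langle f,g\rangle=\int_{I_0}f\bar g$, so $\|f\|^2_{H^2_{\mathrm{dy}}}=\int_{I_0}(u^2+v^2)$. For $f\in H^2_{\mathrm{dy}}$ and $K\in\mathcal{D}^4$ write $f(K)=f_K=\langle f\rangle_K=u_K+iv_K$ for the average over $K$. For $I\in\mathcal{D}^4$, the reproducing kernel $k^{\mathrm{dy}}_I\in H^2_{\mathrm{dy}}$ is the element with $f_I=\langle f,k^{\mathrm{dy}}_I\rangle$ for all $f\in H^2_{\mathrm{dy}}$. Explicitly, $$k^{\mathrm{dy}}_I=1+\frac1{2|I|}\sum_{J\in\mathcal{D}_o,\,J\supsetneq I}\langle\chi_I,h_J\rangle h_J+\frac i{2|I|}\sum_{J\in\mathcal{D}_o,\,J\supsetneq I}\sigma(J)\langle\chi_I,h_J\rangle h_{J'},$$ where $\mathcal{D}_o$ is the set of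 dyadic subintervals of $I_0$ of length $2^{-n}$ with $n$ odd, $h_J=|J|^{-1/2}(\chi_{J_+}-\chi_{J_-})$, $\sigma(J)=+1$ (resp. $-1$) if $J$ is the right (resp. left) half of its dyadic parent, and $J'$ is the dyadic sibling of $J$. The normalized reproducing kernel is $\tilde k^{\mathrm{dy}}_I=k^{\mathrm{dy}}_I/\|k^{\mathrm{dy}}_I\|_{H^2_{\mathrm{dy}}}$, and $$\|\tilde k^{\mathrm{dy}}_I\|^2_{\ell^2_\mu}=\sum_{K\in\mathcal{D}^4}\mu_K\,|\tilde k^{\mathrm{dy}}_I(K)|^2 .$$ A sequence $(\mu_I)_{I\in\mathcal{D}^4}$ is balanced if for all $I\in\mathcal{D}^4$ $$\frac1{|I^x|}\sum_{J\in\mathcal{D}^4(I^x)}\mu_J=\frac1{|I^y|}\sum_{J\in\mathcal{D}^4(I^y)}\mu_J=\frac1{|I|}\sum_{J\in\mathcal{D}^4(I)}\mu_J-\frac{\mu_I}{|I|} .$$ *)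

(* Defs.v *)
From HB Require Import structures.
From mathcomp Require Import all_boot all_order all_algebra.
From mathcomp Require Import complex ring.
From mathcomp Require Import all_classical all_reals all_analysis.
Set Implicit Arguments.
Unset Strict Implicit.
Unset Printing Implicit Defensive.
Import Order.TTheory GRing.Theory Num.Theory.
Import numFieldNormedType.Exports.
Local Open Scope classical_set_scope.
Local Open Scope ring_scope.
Local Open Scope complex_scope.

(* Index (k, n), n < 4 ^ k, of the 4-adic interval [n 4^-k, (n+1) 4^-k). *)
Definition D4 : choiceType := {k : nat & 'I_(4 ^ k)}.

Definition D4_at (k : nat) (n : 'I_(4 ^ k)) : D4 :=
  Tagged (fun k => 'I_(4 ^ k)) n.

Lemma D4_child_subproof (I : D4) (j : 'I_4) :
  (4 * tagged I + j < 4 ^ (tag I).+1)%N.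
Proof.
case: I => k n /=; rewrite expnS.
apply: (@leq_trans (4 * n + 4)); first by rewrite ltn_add2l.
by rewrite -mulnSr leq_mul2l ltn_ord.
Qed.

(* The j-th quarter from the left. *)
Definition D4_child (I : D4) (j : 'I_4) : D4 :=
  @D4_at (tag I).+1 (Ordinal (D4_child_subproof I j)).

Definition child_ym (I : D4) : D4 := D4_child I (@Ordinal 4 0 isT).
Definition child_yp (I : D4) : D4 := D4_child I (@Ordinal 4 1 isT).
Definition child_xm (I : D4) : D4 := D4_child I (@Ordinal 4 2 isT).
Definition child_xp (I : D4) : D4 := D4_child I (@Ordinal 4 3 isT).

Section DyadicHardySpace.
Context {R : realType}.

(* A half-open interval [a, b) is given by its pair of endpoints (a, b). *)
Definition pts (K : R * R) : set R := `[K.1, K.2[%classic.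
Definition len (K : R * R) : R := K.2 - K.1.
Definition lhalf (K : R * R) : R * R := (K.1, (K.1 + K.2) / 2).
Definition rhalf (K : R * R) : R * R := ((K.1 + K.2) / 2, K.2).

Definition itv4 (I : D4) : R * R :=
  ((tagged I : nat)%:R / 4 ^+ tag I, (tagged I : nat).+1%:R / 4 ^+ tag I).
Definition itv_y (I : D4) : R * R := lhalf (itv4 I).
Definition itv_x (I : D4) : R * R := rhalf (itv4 I).


Lemma itv4_childE (I : D4) :
  [/\ itv4 (child_ym I) = lhalf (itv_y I), itv4 (child_yp I) = rhalf (itv_y I),
      itv4 (child_xm I) = lhalf (itv_x I) & itv4 (child_xp I) = rhalf (itv_x I)].
Proof.
have h k : (4 ^+ k : R) != 0 by rewrite expf_neq0.
case: I => k n; rewrite /itv_x /itv_y /lhalf /rhalf /itv4 /= exprS.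
by split; congr pair; rewrite -!natr1 natrD natrM; field; rewrite ?h.
Qed.

Definition I0 : set R := `[0, 1[%classic.

Definition is_sliced (u : D4 -> R) : Prop :=
  forall I : D4,
    u I = (u (child_xp I) + u (child_xm I)) / 2 /\
    u I = (u (child_yp I) + u (child_ym I)) / 2.

Definition incr_x (u : D4 -> R) (I : D4) : R :=
  (u (child_xp I) - u (child_xm I)) / 2.
Definition incr_y (u : D4 -> R) (I : D4) : R :=
  (u (child_yp I) - u (child_ym I)) / 2.

Definition L2_bounded (u : D4 -> R) : Prop :=
  exists M : R, forall k : nat,
    \sum_(n < 4 ^ k) len (itv4 (D4_at n)) * u (D4_at n) ^+ 2 <= M.

Definition mean (u : R -> R) (K : R * R) : R :=
  (len K)^-1 * Rintegral lebesgue_measure (pts K) u.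

Definition in_L2 (u : R -> R) : Prop :=
  measurable_fun I0 u /\
  lebesgue_measure.-integrable I0 (fun x => (u x ^+ 2)%:E).

(* The function equal to u_I on each I of generation k. *)
Definition step (u : D4 -> R) (k : nat) (x : R) : R :=
  \sum_(n < 4 ^ k) u (D4_at n) * \1_(pts (itv4 (D4_at n))) x.

Definition is_L2_limit (u : D4 -> R) (b : R -> R) : Prop :=
  in_L2 b /\
  (fun k => \int[lebesgue_measure]_(x in I0) ((step u k x - b x) ^+ 2)%:E)%E
    @ \oo --> 0%E.

(* An L^2 integrable sliced dyadic martingale is identified with its L^2 limit
   b; the family itself is recovered as the averages of b. *)
Definition averages (b : R -> R) (I : D4) : R := mean b (itv4 I).

Definition sliced_L2 (b : R -> R) : Prop :=
  [/\ is_sliced (averages b), L2_bounded (averages b) & is_L2_limit (averages b) b].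

Definition re_part (f : R -> R[i]) (x : R) : R := complex.Re (f x).
Definition im_part (f : R -> R[i]) (x : R) : R := complex.Im (f x).

Definition cauchy_riemann (u v : D4 -> R) : Prop :=
  forall I : D4, incr_x u I = incr_y v I /\ incr_y u I = - incr_x v I.

(* Elements are functions, not classes modulo a.e. equality on I0; their values
   outside I0 are irrelevant. *)
Definition H2dy (f : R -> R[i]) : Prop :=
  [/\ sliced_L2 (re_part f), sliced_L2 (im_part f) &
      cauchy_riemann (averages (re_part f)) (averages (im_part f))].

Definition cintegral (f : R -> R[i]) : R[i] :=
  Rintegral lebesgue_measure I0 (re_part f)
  +i* Rintegral lebesgue_measure I0 (im_part f).

Definition inner (f g : R -> R[i]) : R[i] :=
  cintegral (fun x => f x * (g x)^*).

Definition H2norm_sq (f : R -> R[i]) : R :=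
  Rintegral lebesgue_measure I0 (fun x => re_part f x ^+ 2 + im_part f x ^+ 2).

Definition at_interval (f : R -> R[i]) (K : D4) : R[i] :=
  averages (re_part f) K +i* averages (im_part f) K.

(* Determines k up to a.e. equality on I0. *)
Definition is_repr_kernel (I : D4) (k : R -> R[i]) : Prop :=
  H2dy k /\ forall f : R -> R[i], H2dy f -> at_interval f I = inner f k.

Definition normalize (k : R -> R[i]) (x : R) : R[i] :=
  k x / (Num.sqrt (H2norm_sq k))%:C.

Definition ell2_norm_sq (mu : D4 -> R) (f : R -> R[i]) : \bar R :=
  \esum_(K in [set: D4]) (mu K * ComplexField.Normc.normc (at_interval f K) ^+ 2)%:E.

Definition D4_in (K : R * R) : set D4 := [set J | pts (itv4 J) `<=` pts K].

(* |K|^-1 times the mass of D4(K); meaningful for nonnegative mu, as esum is a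
   supremum of finite sums. *)
Definition density (mu : D4 -> R) (K : R * R) : \bar R :=
  ((len K)^-1%:E * \esum_(J in D4_in K) (mu J)%:E)%E.

Definition balanced (mu : D4 -> R) : Prop :=
  forall I : D4,
    density mu (itv_x I) = density mu (itv_y I) /\
    density mu (itv_y I) =
      (density mu (itv4 I) - (mu I / len (itv4 I))%:E)%E.

End DyadicHardySpace.

(* Main.v *)
Require Import Defs.
From mathcomp Require Import all_boot all_order all_algebra.
From mathcomp Require Import complex ring lra.
From mathcomp Require Import all_classical all_reals all_analysis.
From mathcomp Require Import measurable_realfun.
Set Implicit Arguments.
Unset Strict Implicit.
Unset Printing Implicit Defensive.
Import Order.TTheory GRing.Theory Num.Theory.
Import numFieldNormedType.Exports.
Local Open Scope classical_set_scope.
Local Open Scope ring_scope.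

(** Write f = u + iv and d = incr_x u I - i incr_y u I.  Slicedness and the
dyadic Cauchy-Riemann equations together say that f takes the values
f_I - id, f_I + id, f_I - d, f_I + d on the four children of I, from left to
right: f is a martingale whose four increments at I are the products of one
complex number by the fourth roots of unity.  Everything rests on this
conformality ([conformal_child]).

Testing.  By orthogonality of the increments, the reproducing kernel of I is
the function whose increment at each strict ancestor J of I is the conjugate
of the root of unity leading from J towards I, multiplied by 1/|J|, and which
is constant below I.  Its value on I, which is also its squared norm, is
1 + (1 + 4 + ... + 4^(n-1)) = (4^n + 2)/3 where |I| = 4^-n.  The normalized
kernel therefore has squared modulus at least 1/(3|I|) on all subintervals of
I, and testing on it yields the Carleson condition
sum_(J <= I) mu_J <= 3 Imu |I| ([mass_le_testing]).  Since the kernel bound is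
a supremum over elements of the Hardy space, the kernels are constructed as
honest step functions ([exists_kernel_family], [kernel_fun_repr]).

Embedding.  Put C = 3 Imu and M_I = |I|^-1 sum_(J <= I) mu_J, so that
0 <= M <= C.  Balancedness says exactly that the mean of M over either pair of
children, x or y, is M_I - mu_I/|I|.  In the continuous setting, |f|^2 exp(phi)
has Laplacian at least |f|^2 exp(phi) times that of phi when f is holomorphic;
this is how Uchiyama obtains the constant e in the Carleson embedding theorem.
Its dyadic counterpart with phi = - M/C is [bellman_inequality]: weighting
the four values of |f|^2 by exponentials that are reciprocal within each pair
of children never brings their mean below the central value.
Hence the mean of |f|^2 exp(-M/C) over the children of I exceeds the value at I
by at least |f_I|^2 mu_I/(e C |I|) ([carleson_step]).  Summing over the first
n generations bounds the left-hand side by e C times the energy of f at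
generation n, which is at most the squared norm of f by Jensen's inequality
([averages_energy_le]). *)

(** * The tree of 4-adic intervals *)

Lemma D4_parent_subproof k (n : 'I_(4 ^ k.+1)) : (n %/ 4 < 4 ^ k)%N.
Proof. by rewrite ltn_divLR // -expnSr. Qed.

Lemma D4_at_child k (n : 'I_(4 ^ k.+1)) :
  D4_at n = D4_child (D4_at (Ordinal (D4_parent_subproof n)))
                     (Ordinal (ltn_pmod n (isT : 0 < 4)%N)).
Proof.
rewrite /D4_child /D4_at /Tagged; congr (existT _ _ _); apply: val_inj => /=.
by rewrite mulnC -divn_eq.
Qed.

Definition D4_root : D4 := @D4_at 0 ord0.

Lemma D4_ind (P : D4 -> Prop) :
  P D4_root -> (forall I j, P I -> P (D4_child I j)) -> forall J, P J.
Proof.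
move=> P0 Pc [k]; elim: k => [|k IHk] n; last first.
  by rewrite -[existT _ _ _]/(D4_at n) D4_at_child; apply: Pc; apply: IHk.
by rewrite (_ : n = ord0) //; apply: val_inj => /=; case: n => -[].
Qed.

Lemma ord4_ind (P : 'I_4 -> Prop) :
  P (Ordinal (isT : 0 < 4)%N) -> P (Ordinal (isT : 1 < 4)%N) ->
  P (Ordinal (isT : 2 < 4)%N) -> P (Ordinal (isT : 3 < 4)%N) -> forall j, P j.
Proof.
move=> h0 h1 h2 h3 [[|[|[|[|j]]]] hj] //;
by [rewrite (bool_irrelevance hj isT)].
Qed.

Lemma sum_children (V : nmodType) (I : D4) (F : D4 -> V) :
  \sum_(j < 4) F (D4_child I j) =
  F (child_ym I) + F (child_yp I) + F (child_xm I) + F (child_xp I).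
Proof.
rewrite !big_ord_recr big_ord0 /= add0r.
by congr (F _ + F _ + F _ + F _); congr (D4_child _ _); apply: val_inj.
Qed.

Lemma sum_generationS (V : nmodType) (k : nat) (F : D4 -> V) :
  \sum_(n < 4 ^ k.+1) F (D4_at n) =
  \sum_(n < 4 ^ k) \sum_(j < 4) F (D4_child (D4_at n) j).
Proof.
rewrite pair_bigA /=.
pose h (nj : 'I_(4 ^ k) * 'I_4) : 'I_(4 ^ k.+1) :=
  Ordinal (D4_child_subproof (D4_at nj.1) nj.2).
pose g (n : 'I_(4 ^ k.+1)) : 'I_(4 ^ k) * 'I_4 :=
  (Ordinal (D4_parent_subproof n), Ordinal (ltn_pmod n (isT : 0 < 4)%N)).
rewrite (reindex h) //; exists g => [[n j] _|n _]; last first.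
  by apply: val_inj => /=; rewrite mulnC -divn_eq.
congr pair; apply: val_inj => /=; last by rewrite mulnC modnMDl modn_small.
by rewrite mulnC divnMDl // divn_small // addn0.
Qed.

Lemma sum_generation0 (V : nmodType) (F : D4 -> V) :
  \sum_(n < 4 ^ 0) F (D4_at n) = F D4_root.
Proof. by rewrite big_ord1. Qed.

(** * The Bellman inequality *)

(** With f = u + iv and d = a - ib, the right-hand side without the common
factor exp(-m) is e^-p |f+d|^2 + e^p |f-d|^2 + e^-q |f+id|^2 + e^q |f-id|^2.
With P = cosh p and Q = cosh q it equals
2 (P + Q) (|f|^2 + |d|^2) plus a cross term, which Cauchy-Schwarz controls by
sinh^2 p + sinh^2 q = P^2 + Q^2 - 2 <= (P + Q) (P + Q - 2), that is
(P - 1) (Q - 1) >= 0; the arithmetic-geometric inequality concludes. *)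
Lemma bellman_inequality (R : realType) (u v a b m p q : R) :
  4 * (expR (- m) * (u ^+ 2 + v ^+ 2)) <=
  expR (- (m + p)) * ((u + a) ^+ 2 + (v - b) ^+ 2) +
  expR (- (m - p)) * ((u - a) ^+ 2 + (v + b) ^+ 2) +
  expR (- (m + q)) * ((u + b) ^+ 2 + (v + a) ^+ 2) +
  expR (- (m - q)) * ((u - b) ^+ 2 + (v - a) ^+ 2).
Proof.
rewrite !opprD !opprK !expRD.
set E := expR (- m); set P := expR (- p); set P' := expR p.
set Q := expR (- q); set Q' := expR q.
have PP : P * P' = 1 by rewrite -expRD addNr expR0.
have QQ : Q * Q' = 1 by rewrite -expRD addNr expR0.
have P0 : 0 < P by exact: expR_gt0.
have P'0 : 0 < P' by exact: expR_gt0.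
have Q0 : 0 < Q by exact: expR_gt0.
have Q'0 : 0 < Q' by exact: expR_gt0.
suff H : 4 * (u ^+ 2 + v ^+ 2) <=
  P * ((u + a) ^+ 2 + (v - b) ^+ 2) +
  P' * ((u - a) ^+ 2 + (v + b) ^+ 2) +
  Q * ((u + b) ^+ 2 + (v + a) ^+ 2) +
  Q' * ((u - b) ^+ 2 + (v - a) ^+ 2).
  have := ler_wpM2l (ltW (expR_gt0 (- m))) H; rewrite -/E; lra.
pose F := u ^+ 2 + v ^+ 2; pose D := a ^+ 2 + b ^+ 2.
pose s := u * a - v * b; pose t := u * b + v * a.
pose c := (P + P') / 2; pose d := (Q + Q') / 2.
pose x := (P - P') / 2; pose y := (Q - Q') / 2.
(* From here on c, d and x, y are the hyperbolic cosines and (negated) sines of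
   p, q, while s, t are the real parts of f times the conjugates of the two
   increments; s^2 + t^2 = F D because these increments differ by a factor i. *)
have c1 : 1 <= c.
  have : 0 <= P * (P + P' - 2) by have := sqr_ge0 (P - 1); lra.
  by rewrite pmulr_rge0 // /c; lra.
have d1 : 1 <= d.
  have : 0 <= Q * (Q + Q' - 2) by have := sqr_ge0 (Q - 1); lra.
  by rewrite pmulr_rge0 // /d; lra.
have xc : x ^+ 2 = c ^+ 2 - 1.
  have : c ^+ 2 - x ^+ 2 = P * P' by rewrite /c /x; field.
  by rewrite PP; lra.
have yd : y ^+ 2 = d ^+ 2 - 1.
  have : d ^+ 2 - y ^+ 2 = Q * Q' by rewrite /d /y; field.
  by rewrite QQ; lra.
have F0 : 0 <= F by rewrite addr_ge0 ?sqr_ge0.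
have D0 : 0 <= D by rewrite addr_ge0 ?sqr_ge0.
have st : s ^+ 2 + t ^+ 2 = F * D by rewrite /s /t /F /D; ring.
have CS : (x * s + y * t) ^+ 2 <= (c + d) * (c + d - 2) * (F * D).
  apply: (@le_trans _ _ ((x ^+ 2 + y ^+ 2) * (s ^+ 2 + t ^+ 2))).
    by have := sqr_ge0 (x * t - y * s); lra.
  rewrite st xc yd ler_wpM2r ?mulr_ge0 //; nra.
have AM : 0 <= (c + d - 2) * F + (c + d) * D + 2 * (x * s + y * t).
  set S := (c + d - 2) * F + (c + d) * D.
  have S0 : 0 <= S by rewrite addr_ge0 ?mulr_ge0 //; lra.
  have S2 : (2 * (x * s + y * t)) ^+ 2 <= S ^+ 2.
    by rewrite /S; have := sqr_ge0 ((c + d - 2) * F - (c + d) * D); lra.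
  have : `|2 * (x * s + y * t)| <= S.
    by rewrite -(ger0_norm S0) -ler_sqr ?nnegrE // !real_normK ?num_real.
  by rewrite ler_norml => /andP[]; lra.
move: AM; rewrite /c /d /x /y /s /t /F /D; lra.
Qed.

(** * Integrals and averages over 4-adic intervals *)

Section Geometry.
Context {R : realType}.
Implicit Types (I J : D4) (K : R * R) (g u s : R -> R).
Local Notation leb := (@lebesgue_measure R).

Lemma expr4_gt0 (k : nat) : 0 < 4 ^+ k :> R.
Proof. exact: exprn_gt0. Qed.

Lemma len_itv4 I : len (itv4 I) = (4 ^+ tag I)^-1 :> R.
Proof. by rewrite /len /itv4 /= -mulrBl -natr1 addrAC subrr add0r mul1r. Qed.

Lemma len_itv4_gt0 I : 0 < len (itv4 I) :> R.
Proof. by rewrite len_itv4 invr_gt0 expr4_gt0. Qed.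

Lemma len_child I j : len (itv4 (D4_child I j)) = len (itv4 I) / 4 :> R.
Proof. by rewrite !len_itv4 /= exprS invfM mulrC. Qed.

Lemma len_lhalf K : len (lhalf K) = len K / 2.
Proof. by rewrite /len /lhalf /=; field. Qed.

Lemma len_rhalf K : len (rhalf K) = len K / 2.
Proof. by rewrite /len /rhalf /=; field. Qed.

Lemma pts_halves K : 0 <= len K -> pts K = pts (lhalf K) `|` pts (rhalf K).
Proof.
rewrite /len => K0; apply/seteqP; split => x; rewrite /pts /lhalf /rhalf /= !in_itv /=.
  move=> /andP[a b]; have [xm|xm] := ltP x ((K.1 + K.2) / 2); [left|right];
  by rewrite ?a ?b ?xm.
by case=> /andP[a b]; apply/andP; split=> //; lra.
Qed.

Lemma disj_halves K : [disjoint pts (lhalf K) & pts (rhalf K)].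
Proof.
rewrite disj_set2E; apply/eqP/seteqP; split => // x [].
by rewrite /pts /= !in_itv /= => /andP[_ /lt_geF ->].
Qed.

Lemma measurable_pts K : measurable (pts K).
Proof. exact: measurable_itv. Qed.

Lemma measurable_I0 : measurable (@I0 R).
Proof. exact: measurable_itv. Qed.

Lemma lebesgue_pts K : 0 < len K -> leb (pts K) = (len K)%:E.
Proof.
by rewrite /len subr_gt0 => K0; rewrite /pts lebesgue_measure_itv /= lte_fin K0 -EFinB.
Qed.

Lemma itv4_root : itv4 D4_root = (0, 1) :> R * R.
Proof. by rewrite /itv4 /= expr0 !divr1. Qed.

Lemma pts_root : pts (itv4 D4_root) = @I0 R.
Proof. by rewrite itv4_root. Qed.

Lemma pts_quarters I :
  [/\ pts (itv4 I) = pts (itv_y I) `|` pts (itv_x I) :> set R,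
      pts (itv_y I) = pts (itv4 (child_ym I)) `|` pts (itv4 (child_yp I)) :> set R &
      pts (itv_x I) = pts (itv4 (child_xm I)) `|` pts (itv4 (child_xp I)) :> set R].
Proof.
have h := len_itv4_gt0 I; case: (@itv4_childE R I) => -> -> -> ->.
by split; apply: pts_halves; rewrite /itv_x /itv_y ?len_lhalf ?len_rhalf; lra.
Qed.

Lemma pts_child I j : pts (@itv4 R (D4_child I j)) `<=` pts (itv4 I).
Proof.
have [e ey ex] := pts_quarters I.
elim/ord4_ind: j => x.
- by move=> xI; rewrite e ey; left; left.
- by move=> xI; rewrite e ey; left; right.
- by move=> xI; rewrite e ex; right; left.
- by move=> xI; rewrite e ex; right; right.
Qed.

Lemma pts_itv4_sub I : pts (itv4 I) `<=` @I0 R.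
Proof.
elim/D4_ind: I => [|I j IH]; first by rewrite pts_root.
exact: subset_trans (@pts_child I j) IH.
Qed.

Definition integrable_I0 g := leb.-integrable I0 (EFin \o g).

Lemma integrable_I0_pts g K : pts K `<=` I0 -> integrable_I0 g ->
  leb.-integrable (pts K) (EFin \o g).
Proof.
move=> KI; apply: (@integrableS _ _ _ leb I0) => //; [exact: measurable_I0|exact: measurable_pts].
Qed.

Lemma integrable_I0_itv4 g I : integrable_I0 g -> leb.-integrable (pts (itv4 I)) (EFin \o g).
Proof. by apply: integrable_I0_pts; exact: pts_itv4_sub. Qed.

Lemma Rintegral_children g I : integrable_I0 g ->
  \int[leb]_(x in pts (itv4 I)) g x =
  \sum_(j < 4) \int[leb]_(x in pts (itv4 (D4_child I j))) g x.
Proof.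
move=> ig; have iI := @integrable_I0_itv4 _ I ig.
have [e ey ex] := pts_quarters I.
have ixy : leb.-integrable (pts (itv_y I)) (EFin \o g) /\
           leb.-integrable (pts (itv_x I)) (EFin \o g).
  by split; apply: integrable_I0_pts => //; apply: subset_trans (@pts_itv4_sub I);
    rewrite e; [exact: subsetUl|exact: subsetUr].
have [iy ix] := ixy.
rewrite (@sum_children _ I (fun J => \int[leb]_(x in pts (itv4 J)) g x)).
rewrite e Rintegral_setU -?e //; [|exact: measurable_pts|exact: measurable_pts|exact: disj_halves].
rewrite ey Rintegral_setU -?ey //; [|exact: measurable_pts|exact: measurable_pts|].
  rewrite ex Rintegral_setU -?ex //; [|exact: measurable_pts|exact: measurable_pts|].
    exact: addrA.
  by case: (@itv4_childE R I) => _ _ -> ->; exact: disj_halves.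
by case: (@itv4_childE R I) => -> -> _ _; exact: disj_halves.
Qed.

Lemma Rintegral_generation g k : integrable_I0 g ->
  \int[leb]_(x in I0) g x =
  \sum_(n < 4 ^ k) \int[leb]_(x in pts (itv4 (D4_at n))) g x.
Proof.
move=> ig; elim: k => [|k ->].
  by rewrite (sum_generation0 (fun J => \int[leb]_(x in pts (itv4 J)) g x)) pts_root.
rewrite (sum_generationS k (fun J => \int[leb]_(x in pts (itv4 J)) g x)).
by apply: eq_bigr => n _; exact: Rintegral_children.
Qed.

Lemma averages_children g I : integrable_I0 g ->
  averages g I = (\sum_(j < 4) averages g (D4_child I j)) / 4.
Proof.
move=> ig; rewrite /averages /mean Rintegral_children //.
rewrite mulr_sumr mulr_suml; apply: eq_bigr => j _; rewrite len_child.
by have := len_itv4_gt0 I => h; field; rewrite gt_eqF.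
Qed.

Lemma Rintegral_averages g I :
  \int[leb]_(x in pts (itv4 I)) g x = len (itv4 I) * averages g I.
Proof.
by rewrite /averages /mean mulrA mulfV ?mul1r // gt_eqF // len_itv4_gt0.
Qed.

Lemma Rintegral_const_on (c : R) g I : (forall x, pts (itv4 I) x -> g x = c) ->
  \int[leb]_(x in pts (itv4 I)) g x = len (itv4 I) * c.
Proof.
move=> gc; rewrite (@eq_Rintegral _ _ _ _ _ (fun=> c)); last first.
  by move=> x /set_mem; exact: gc.
rewrite Rintegral_cst; last exact: measurable_pts.
by rewrite [X in fine X](lebesgue_pts (len_itv4_gt0 I)) mulrC.
Qed.

Lemma averages_const_on (c : R) g I : (forall x, pts (itv4 I) x -> g x = c) ->
  averages g I = c.
Proof.
move=> gc; rewrite /averages /mean (Rintegral_const_on gc) mulrA mulVf ?mul1r //.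
by rewrite gt_eqF // len_itv4_gt0.
Qed.

Lemma integrable_I0_cst (c : R) : integrable_I0 (fun=> c).
Proof.
apply: measurable_bounded_integrable => //; first exact: measurable_I0.
  by rewrite -pts_root [X in (X < _)%E](lebesgue_pts (len_itv4_gt0 _)) ltry.
by exists `|c|; split; [exact: num_real|move=> M hM x _ /=; exact: ltW].
Qed.

(** Needed for pairing an element of the Hardy space with a kernel; taking s
constant gives integrability of square-integrable functions on I0. *)
Lemma integrable_I0_mul u s : in_L2 u -> in_L2 s -> integrable_I0 (fun x => u x * s x).
Proof.
move=> [hu iu] [hs is_]; apply: (@le_integrable _ _ _ leb I0 measurable_I0 _
  (fun x => ((u x ^+ 2)%:E + (s x ^+ 2)%:E)%E)).
- by apply/measurable_EFinP; exact: measurable_funM.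
- move=> x _ /=; rewrite lee_fin normrM [leRHS]ger0_norm ?addr_ge0 ?sqr_ge0 //.
  rewrite -(real_normK (num_real (u x))) -(real_normK (num_real (s x))).
  have := sqr_ge0 (`|u x| - `|s x|).
  by have := mulr_ge0 (normr_ge0 (u x)) (normr_ge0 (s x)); lra.
- exact: (@integrableD _ _ _ leb I0 measurable_I0 _ _ iu is_).
Qed.

Lemma in_L2_cst (c : R) : in_L2 (fun=> c).
Proof. by split; [exact: measurable_cst|exact: (integrable_I0_cst (c ^+ 2))]. Qed.

Lemma in_L2_integrable u : in_L2 u -> integrable_I0 u.
Proof.
move=> /integrable_I0_mul /(_ (in_L2_cst 1)).
by rewrite /integrable_I0 (_ : (fun x => u x * 1) = u) //; apply/funext => x; rewrite mulr1.
Qed.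

(** Jensen's inequality, obtained by integrating 2cu - c^2 <= u^2, where c is
the average of u. *)
Lemma averages_sqr_le u I : in_L2 u ->
  len (itv4 I) * averages u I ^+ 2 <= \int[leb]_(x in pts (itv4 I)) (u x ^+ 2).
Proof.
move=> Lu; set c := averages u I; have iu := in_L2_integrable Lu.
have mI := measurable_pts (itv4 I).
have i1 : leb.-integrable (pts (itv4 I)) (EFin \o (fun x => 2 * c * u x)).
  exact: (@integrableZl _ _ _ leb _ mI (2 * c) _ (@integrable_I0_itv4 _ I iu)).
have i2 := @integrable_I0_itv4 _ I (integrable_I0_cst (c ^+ 2)).
have -> : len (itv4 I) * c ^+ 2 =
    \int[leb]_(x in pts (itv4 I)) (2 * c * u x - c ^+ 2).
  rewrite RintegralB // RintegralZl //; last exact: integrable_I0_itv4.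
  by rewrite Rintegral_averages (@Rintegral_const_on (c ^+ 2)) // -/c; ring.
apply: le_Rintegral => //.
- exact: (@integrableB _ _ _ leb _ mI _ _ i1 i2).
- by apply: integrable_I0_itv4; case: Lu.
- by move=> x _; have := sqr_ge0 (u x - c); lra.
Qed.

Lemma averages_energy_le u k : in_L2 u ->
  \sum_(n < 4 ^ k) len (itv4 (D4_at n)) * averages u (D4_at n) ^+ 2 <=
  \int[leb]_(x in I0) (u x ^+ 2).
Proof.
move=> Lu; rewrite (@Rintegral_generation _ k); last by case: Lu.
by apply: ler_sum => n _; exact: averages_sqr_le.
Qed.

End Geometry.

(** * Conformal families and the kernel as a family *)

Section ConformalFamilies.
Context {R : realType}.
Implicit Types (I J P : D4) (u v p q A B : D4 -> R).

Definition conformal u v : Prop :=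
  [/\ is_sliced u, is_sliced v & cauchy_riemann u v].

(** The root of unity attached to the j-th quarter is wx j + i wy j: the
quarters y-, y+, x-, x+ carry -i, i, -1, 1. *)
Definition wx (j : nat) : R := (j == 3)%:R - (j == 2)%:R.
Definition wy (j : nat) : R := (j == 1)%:R - (j == 0)%:R.

Lemma conformal_child u v I (j : 'I_4) : conformal u v ->
  u (D4_child I j) = u I + wx j * incr_x u I + wy j * incr_y u I /\
  v (D4_child I j) = v I + wy j * incr_x u I - wx j * incr_y u I.
Proof.
case=> /(_ I)[ux uy] /(_ I)[vx vy] /(_ I)[c1 c2].
move: c1 c2; rewrite /incr_x /incr_y => c1 c2.
rewrite /child_xp /child_xm /child_yp /child_ym in ux uy vx vy c1 c2 *.
by elim/ord4_ind: j; rewrite /wx /wy /=; split; lra.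
Qed.

(** Multiplication of u + iv by -i. It reduces statements about imaginary parts
to statements about real parts. *)
Lemma conformal_rot u v : conformal u v -> conformal v (fun I => - u I).
Proof.
case=> su sv cr; split=> // I; first by case: (su I) => h1 h2; split; lra.
case: (cr I) => h1 h2; move: h1 h2; rewrite /incr_x /incr_y; split; lra.
Qed.

(** The martingale with prescribed increments A J (in x) and B J (in y) and
value c at the root. *)
Fixpoint walk_at c A B k : 'I_(4 ^ k) -> R :=
  match k with
  | 0 => fun=> c
  | k.+1 => fun n =>
      let m := Ordinal (D4_parent_subproof n) in
      walk_at c A B m + wx (n %% 4) * A (D4_at m) + wy (n %% 4) * B (D4_at m)
  end.

Definition walk c A B J : R := walk_at c A B (tagged J).

Lemma walk_child c A B J (j : 'I_4) :
  walk c A B (D4_child J j) = walk c A B J + wx j * A J + wy j * B J.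
Proof.
case: J => k n; rewrite /walk /=.
have -> : Ordinal (D4_parent_subproof (Ordinal (D4_child_subproof (existT _ k n) j))) = n.
  by apply: val_inj; rewrite /= mulnC divnMDl // divn_small // addn0.
by rewrite mulnC modnMDl modn_small.
Qed.

Lemma walk_conformal c c' A B :
  conformal (walk c A B) (walk c' (fun J => - B J) A).
Proof.
split=> I; rewrite /incr_x /incr_y /child_xp /child_xm /child_yp /child_ym
  !walk_child /wx /wy /=; split; lra.
Qed.

Lemma conformalD u v p q : conformal u v -> conformal p q ->
  conformal (fun I => u I + p I) (fun I => v I + q I).
Proof.
move=> [su sv cu] [sp sq cp]; split=> I.
- by have [? ?] := su I; have [? ?] := sp I; split; lra.
- by have [? ?] := sv I; have [? ?] := sq I; split; lra.
- by have [] := cu I; have [] := cp I; rewrite /incr_x /incr_y; split; lra.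
Qed.

(** Among sliced families, these are the averages of step functions of
generation n. *)
Definition settled n u : Prop :=
  forall J j, (n <= tag J)%N -> u (D4_child J j) = u J.

Lemma settledW m n u : (m <= n)%N -> settled m u -> settled n u.
Proof. by move=> mn su J j nJ; apply: su; exact: leq_trans nJ. Qed.

Lemma walk_settled c A B n : (forall J, (n <= tag J)%N -> A J = 0 /\ B J = 0) ->
  settled n (walk c A B).
Proof. by move=> AB J j /AB[A0 B0]; rewrite walk_child A0 B0 !mulr0 !addr0. Qed.

Lemma walk_early c A B n : (forall J, (tag J < n)%N -> A J = 0 /\ B J = 0) ->
  forall J, (tag J <= n)%N -> walk c A B J = c.
Proof.
move=> AB; elim/D4_ind => [//|I j IH Ij]; have [A0 B0] := AB I Ij.
by rewrite walk_child A0 B0 !mulr0 !addr0 IH // ltnW.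
Qed.

(** The real part of the inner product of u + iv and p + iq, computed at
generation n. *)
Definition pairing n u v p q : R :=
  \sum_(m < 4 ^ n) len (itv4 (D4_at m)) *
    (u (D4_at m) * p (D4_at m) + v (D4_at m) * q (D4_at m)).

(** A settled second factor has no increments, so only the means of u and v over
the children contribute. *)
Lemma pairing_settled n u v p q : conformal u v -> settled n p -> settled n q ->
  pairing n.+1 u v p q = pairing n u v p q.
Proof.
move=> [su sv _] sp sq; rewrite /pairing.
rewrite (sum_generationS n (fun J => len (itv4 J) * (u J * p J + v J * q J))).
apply: eq_bigr => m _; set J := D4_at m.
under eq_bigr => j _ do rewrite len_child sp // sq //.
rewrite (@sum_children _ J (fun K => len (itv4 J) / 4 * (u K * p J + v K * q J))).
by have [ux uy] := su J; have [vx vy] := sv J; nra.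
Qed.

(** The averages p + iq of the reproducing kernel of I. Reproducing real parts is
enough: [conformal_rot] gives the imaginary parts. *)
Definition is_kernel_family I p q : Prop :=
  [/\ conformal p q, settled (tag I) p /\ settled (tag I) q,
      p I = (4 ^+ tag I + 2) / 3, q I = 0 &
      forall u v, conformal u v -> pairing (tag I) u v p q = u I].

(** The kernel of the j-th child of I is that of I plus one increment at I, namely
the conjugate of the j-th root of unity divided by |I|. Pairing this increment
with that of u + iv gives exactly the change of u from I to its child, because
the four children contribute equally to the pairing of the increments. *)
Lemma exists_kernel_family I : exists p q, is_kernel_family I p q.
Proof.
elim/D4_ind: I => [|I j [p [q [cpq [sp sq] pI qI rep]]]].
  exists (fun=> 1), (fun=> 0); split => //.
  - split=> J; rewrite /incr_x /incr_y; split; lra.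
  - by rewrite /= expr0; lra.
  - move=> u v _; rewrite /pairing.
    rewrite (sum_generation0 (fun J => len (itv4 J) * (u J * 1 + v J * 0))).
    by rewrite len_itv4 /= expr0; lra.
pose A J : R := if J == I then wx j * 4 ^+ tag I else 0.
pose B J : R := if J == I then wy j * 4 ^+ tag I else 0.
have AI : A I = wx j * 4 ^+ tag I by rewrite /A eqxx.
have BI : B I = wy j * 4 ^+ tag I by rewrite /B eqxx.
pose d := walk 0 A B; pose e := walk 0 (fun J => - B J) A.
have dS J (i : 'I_4) : d (D4_child J i) = d J + wx i * A J + wy i * B J.
  exact: walk_child.
have eS J (i : 'I_4) : e (D4_child J i) = e J + wx i * - B J + wy i * A J.
  exact: walk_child.
have AB0 J : tag J != tag I -> A J = 0 /\ B J = 0.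
  by move=> ne; rewrite /A /B; case: eqP => // JI; rewrite JI eqxx in ne.
have BA0 J : tag J != tag I -> - B J = 0 /\ A J = 0.
  by move=> /AB0[-> ->]; rewrite oppr0.
have [d0 e0] : (forall J, (tag J <= tag I)%N -> d J = 0) /\
               (forall J, (tag J <= tag I)%N -> e J = 0).
  by split; apply: walk_early => J JI; [apply: AB0|apply: BA0]; rewrite ltn_eqF.
have sd : settled (tag I).+1 d by apply: walk_settled => J JI; apply: AB0; rewrite gtn_eqF.
have se : settled (tag I).+1 e by apply: walk_settled => J JI; apply: BA0; rewrite gtn_eqF.
exists (fun J => p J + d J), (fun J => q J + e J); split.
- by apply: conformalD => //; exact: walk_conformal.
- split=> J i IJ.
    by rewrite sd // (settledW (leqnSn _) sp).
  by rewrite se // (settledW (leqnSn _) sq).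
- rewrite sp // pI dS d0 // AI BI /= exprS.
  suff : wx j * wx j + wy j * wy j = 1.
    by move/(congr1 (fun t => 4 ^+ tag I * t)); lra.
  by elim/ord4_ind: j {A B AI BI d e dS eS AB0 BA0 d0 e0 sd se}; rewrite /wx /wy /=; lra.
- by rewrite sq // qI eS e0 // AI BI; ring.
move=> u v cuv.
have -> : pairing (tag (D4_child I j)) u v (fun J => p J + d J) (fun J => q J + e J) =
    pairing (tag I).+1 u v p q + pairing (tag I).+1 u v d e.
  by rewrite /pairing -big_split /=; apply: eq_bigr => m _; ring.
rewrite pairing_settled // rep // /pairing.
rewrite (sum_generationS _ (fun J => len (itv4 J) * (u J * d J + v J * e J))).
have [-> _] := conformal_child I j cuv.
(* Summing over the four roots of unity kills the means and leaves the
   product of the increments. *)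
have term J : tag J = tag I ->
    \sum_(i < 4) len (itv4 (D4_child J i)) *
      (u (D4_child J i) * d (D4_child J i) + v (D4_child J i) * e (D4_child J i)) =
    len (itv4 J) * (incr_x u J * A J + incr_y u J * B J).
  move=> JI.
  under eq_bigr => i _.
    have [-> ->] := conformal_child J i cuv.
    rewrite len_child dS eS d0 ?JI // e0 ?JI //.
    over.
  by rewrite !big_ord_recr big_ord0 /= /wx /wy /=; field.
under eq_bigr => m _ do rewrite term //.
have IE : I = D4_at (tagged I) by case: (I).
rewrite (bigD1 (tagged I)) //= -IE AI BI len_itv4.
rewrite big1 ?addr0 => [|m mI].
  by have := expr4_gt0 (R:=R) (tag I) => h; field; rewrite gt_eqF.
suff ne : D4_at m != I by rewrite /A /B (negbTE ne); ring.
by rewrite eq_sym eq_Tagged eq_sym.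
Qed.

End ConformalFamilies.

(** * Inclusion of 4-adic intervals *)

Section Nesting.
Context {R : realType}.
Implicit Types (I J P : D4) (x : R).

Lemma same_generation_eq I J x : tag I = tag J ->
  pts (itv4 I) x -> pts (itv4 J) x -> I = J.
Proof.
case: I J => [k n] [k' m] /= kk; case: _ / kk m => m.
rewrite /pts /itv4 /= !in_itv /= => /andP[n1 n2] /andP[m1 m2].
congr existT; apply: val_inj; apply/eqP.
have h := @expr4_gt0 R k.
have := le_lt_trans n1 m2; have := le_lt_trans m1 n2.
by rewrite !ltr_pM2r ?invr_gt0 // !ltr_nat !ltnS eqn_leq => -> ->.
Qed.

Lemma pts_nested P J x : (tag P <= tag J)%N ->
  pts (itv4 P) x -> pts (itv4 J) x -> pts (@itv4 R J) `<=` pts (itv4 P).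
Proof.
elim/D4_ind: J => [|J j IH] /=.
  by rewrite leqn0 => /eqP P0 Px Jx; rewrite (same_generation_eq _ Px Jx).
rewrite leq_eqVlt => /orP[/eqP PJ|PJ] Px Jx.
  by rewrite (same_generation_eq _ Px Jx).
apply: subset_trans (@pts_child _ J j) (IH PJ Px _); exact: pts_child Jx.
Qed.

Lemma pts_left I : pts (itv4 I) (@itv4 R I).1.
Proof.
rewrite /pts /= in_itv /= lexx /=; have := @len_itv4_gt0 R I.
by rewrite /len subr_gt0.
Qed.

Lemma generation_cover k x : I0 x -> exists n : 'I_(4 ^ k), pts (itv4 (D4_at n)) x.
Proof.
elim: k => [|k IH] Ix; first by exists ord0; rewrite -[D4_at _]/D4_root pts_root.
have [n] := IH Ix; have [e ey ex] := @pts_quarters R (D4_at n).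
rewrite e ey ex => -[[]|[]] h; eexists; exact: h.
Qed.

Lemma len_pts_le (L K : R * R) : 0 < len L -> pts L `<=` pts K -> len L <= len K.
Proof.
rewrite /len /pts subr_gt0 => L12 LK.
have /LK : `[L.1, L.2[%classic L.1 by rewrite /= in_itv /= lexx.
rewrite /= in_itv /= => /andP[K1 K2].
suff : L.2 <= K.2 by lra.
rewrite leNgt; apply/negP => KL.
have /LK : `[L.1, L.2[%classic K.2 by rewrite /= in_itv /= (ltW K2) KL.
by rewrite /= in_itv /= ltxx andbF.
Qed.

Lemma tag_le_len I J : (len (itv4 J) <= len (itv4 I) :> R) = (tag I <= tag J)%N.
Proof. by rewrite !len_itv4 lef_pV2 ?posrE ?expr4_gt0 // ler_eXn2l // ltr1n. Qed.

Lemma pts_sub_tag I J : pts (@itv4 R J) `<=` pts (itv4 I) -> (tag I <= tag J)%N.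
Proof. by move/(len_pts_le (len_itv4_gt0 J)); rewrite tag_le_len. Qed.

(** Lengths in D4 are powers of 1/4, so an interval of D4 contained in K, hence of
length at most 2|P|, has length at most |P|; it then lies in P or in P'. *)
Lemma D4_in_split (K : R * R) P P' : pts K = pts (itv4 P) `|` pts (itv4 P') ->
  tag P' = tag P -> len K = len (itv4 P) * 2 ->
  @D4_in R K = @D4_in R (itv4 P) `|` @D4_in R (itv4 P').
Proof.
move=> KP PP lK; apply/seteqP; split => J; last first.
  by rewrite /D4_in /= KP => -[] h; apply: subset_trans h _;
    [exact: subsetUl|exact: subsetUr].
rewrite /D4_in /= => JK.
have PJ : (tag P <= tag J)%N.
  have := len_pts_le (len_itv4_gt0 J) JK; rewrite lK => lJ; rewrite leqNgt; apply/negP => JP.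
  have : 4 * len (itv4 P) <= len (itv4 J) :> R.
    rewrite !len_itv4 ler_pdivrMr ?expr4_gt0 // mulrC ler_pdivlMr ?expr4_gt0 //.
    by rewrite -exprS ler_eXn2l // ltr1n.
  by have := @len_itv4_gt0 R P; lra.
have := JK _ (pts_left J); rewrite KP => -[] Px; [left|right].
  exact: pts_nested PJ Px (pts_left J).
by apply: pts_nested Px (pts_left J); rewrite PP.
Qed.

Lemma D4_in_disjoint P P' : tag P = tag P' -> P <> P' ->
  @D4_in R (itv4 P) `&` @D4_in R (itv4 P') = set0.
Proof.
move=> PP ne; apply/seteqP; split => // J []; rewrite /D4_in /= => h h'.
by apply: ne; apply: same_generation_eq PP (h _ (pts_left J)) (h' _ (pts_left J)).
Qed.

End Nesting.

(** * Step functions as elements of the Hardy space *)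

Section StepFunctions.
Context {R : realType}.
Implicit Types (I J P : D4) (u v w p q : D4 -> R) (b : R -> R).
Local Notation leb := (@lebesgue_measure R).

Lemma step_at u I x : pts (itv4 I) x -> step u (tag I) x = u I.
Proof.
move=> Ix; rewrite /step (bigD1 (tagged I)) //= big1 ?addr0 => [|n nI].
  by rewrite (_ : D4_at (tagged I) = I) ?indicE ?mem_set ?mulr1 //; case: (I).
rewrite indicE memNset ?mulr0 // => nx; move: nI.
suff -> : n = tagged I by rewrite eqxx.
have := @same_generation_eq R I (D4_at n) x erefl Ix nx.
by move/eqP; rewrite eq_Tagged => /eqP.
Qed.

Lemma step_settled u n J x : settled n u -> (n <= tag J)%N ->
  pts (itv4 J) x -> step u n x = u J.
Proof.
move=> su; elim/D4_ind: J => [|J j IH] nJ Jx.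
  by move: nJ; rewrite leqn0 => /eqP ->; exact: step_at Jx.
have [nJ'|] := leqP n (tag J); first by rewrite su // IH //; exact: pts_child Jx.
move=> Jn; rewrite (_ : n = tag (D4_child J j)); first exact: step_at.
by apply/eqP; rewrite eqn_leq nJ.
Qed.

Lemma measurable_step u n : measurable_fun I0 (step u n).
Proof.
apply: measurable_sum => m; apply: measurable_funM; first exact: measurable_cst.
by apply: measurable_indic; exact: measurable_pts.
Qed.

Lemma in_L2_step u n : in_L2 (step u n).
Proof.
split; first exact: measurable_step.
apply: (@measurable_bounded_integrable _ _ _ leb (fun x => step u n x ^+ 2)).
- exact: measurable_I0.
- by rewrite -pts_root [X in (X < _)%E](lebesgue_pts (len_itv4_gt0 _)) ltry.
- by apply: measurable_funX; exact: measurable_step.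
exists ((\sum_(m < 4 ^ n) `|u (D4_at m)|) ^+ 2); split; first exact: num_real.
move=> M hM x _ /=; apply: le_trans (ltW hM).
rewrite normrX lerXn2r ?nnegrE ?sumr_ge0 //.
apply: le_trans (ler_norm_sum _ _ _) _; apply: ler_sum => m _.
by rewrite normrM ler_piMr // indicE; case: (_ \in _); rewrite ?normr1 ?normr0.
Qed.

(** At generations beyond n the step function is constant on the interval; the
other averages follow by descending induction, since u is a martingale. *)
Lemma averages_step u n : is_sliced u -> settled n u -> averages (step u n) = u.
Proof.
move=> slu su; apply/funext.
suff H d : forall J, (n <= tag J + d)%N -> averages (step u n) J = u J.
  by move=> J; apply: (H n); exact: leq_addl.
elim: d => [|d IH] J.
  by rewrite addn0 => nJ; apply: averages_const_on => x; exact: step_settled.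
rewrite addnS => nJ; rewrite averages_children; last first.
  exact/in_L2_integrable/in_L2_step.
under eq_bigr => j _ do rewrite IH //.
by rewrite sum_children; have := slu J; lra.
Qed.

Lemma sliced_L2_step u n : is_sliced u -> settled n u -> sliced_L2 (step u n).
Proof.
move=> slu su; have L2 := in_L2_step u n; have av := averages_step slu su.
split; rewrite ?av //.
  exists (\int[leb]_(x in I0) (step u n x ^+ 2)) => k.
  by rewrite -{1}av; exact: averages_energy_le.
split=> //; apply: cvg_near_cst; exists n => // k /= nk.
apply: integral0_eq => x Ix; have [m Jx] := generation_cover k Ix.
by rewrite (step_settled su _ Jx) // (step_at u Jx) subrr expr0n.
Qed.

Lemma Rintegral_mul_step b w n : in_L2 b ->
  \int[leb]_(x in I0) (b x * step w n x) =
  \sum_(m < 4 ^ n) len (itv4 (D4_at m)) * (averages b (D4_at m) * w (D4_at m)).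
Proof.
move=> Lb; rewrite (@Rintegral_generation _ _ n); last first.
  by apply: integrable_I0_mul => //; exact: in_L2_step.
apply: eq_bigr => m _; set J := D4_at m.
rewrite (@eq_Rintegral _ _ _ leb _ (fun x => b x * w J)); last first.
  by move=> x /set_mem Jx; rewrite -(step_at w Jx).
rewrite RintegralZr; first by rewrite Rintegral_averages; ring.
- exact: measurable_pts.
- exact/integrable_I0_itv4/in_L2_integrable.
Qed.

End StepFunctions.

(** * The reproducing kernels *)

Section Kernel.
Context {R : realType}.
Implicit Types (I J : D4) (p q : D4 -> R) (f : R -> R[i]).
Local Notation leb := (@lebesgue_measure R).
Local Open Scope complex_scope.

Definition kernel_fun I p q (x : R) : R[i] :=
  step p (tag I) x +i* step q (tag I) x.

Lemma H2dy_conformal f : H2dy f ->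
  conformal (averages (re_part f)) (averages (im_part f)).
Proof. by case=> -[su _ _] [sv _ _]. Qed.

Lemma H2dy_in_L2 f : H2dy f -> in_L2 (re_part f) /\ in_L2 (im_part f).
Proof. by case=> -[_ _ [? _]] [_ _ [? _]]. Qed.

Lemma averages_kernel_fun I p q : is_kernel_family I p q ->
  averages (re_part (kernel_fun I p q)) = p /\
  averages (im_part (kernel_fun I p q)) = q.
Proof.
by case=> -[sp sq _] [tp tq] _ _ _; split; exact: averages_step.
Qed.

Lemma H2dy_kernel_fun I p q : is_kernel_family I p q -> H2dy (kernel_fun I p q).
Proof.
move=> kpq; have [ap aq] := averages_kernel_fun kpq.
case: kpq => -[sp sq cpq] [tp tq] _ _ _; split.
- exact: sliced_L2_step.
- exact: sliced_L2_step.
- by rewrite ap aq.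
Qed.

Lemma kernel_fun_repr I p q : is_kernel_family I p q ->
  is_repr_kernel I (kernel_fun I p q).
Proof.
move=> kpq; split; first exact: H2dy_kernel_fun.
move=> f Hf; have cf := H2dy_conformal Hf; have [Lu Lv] := H2dy_in_L2 Hf.
case: kpq => -[sp sq cpq] [tp tq] _ _ rep.
have im b w : in_L2 b -> leb.-integrable I0 (EFin \o (fun x => b x * step w (tag I) x)).
  by move=> Lb; apply: integrable_I0_mul => //; exact: in_L2_step.
rewrite /at_interval /inner /cintegral; congr (_ +i* _).
- rewrite (@eq_Rintegral _ _ _ leb _
    (fun x => re_part f x * step p (tag I) x + im_part f x * step q (tag I) x)); last first.
    move=> x _; rewrite /re_part /im_part /kernel_fun; case: (f x) => a b /=; ring.
  rewrite RintegralD; [|exact: measurable_I0|exact: im|exact: im].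
  rewrite !Rintegral_mul_step // -big_split /= -(rep _ _ cf).
  by apply: eq_bigr => m _; rewrite mulrDr.
- rewrite (@eq_Rintegral _ _ _ leb _
    (fun x => im_part f x * step p (tag I) x - re_part f x * step q (tag I) x)); last first.
    move=> x _; rewrite /re_part /im_part /kernel_fun; case: (f x) => a b /=; ring.
  rewrite RintegralB; [|exact: measurable_I0|exact: im|exact: im].
  rewrite !Rintegral_mul_step // -sumrB /= -(rep _ _ (conformal_rot cf)).
  by apply: eq_bigr => m _; ring.
Qed.

Lemma H2norm_sqE f : H2dy f ->
  H2norm_sq f = \int[leb]_(x in I0) (re_part f x ^+ 2) +
                \int[leb]_(x in I0) (im_part f x ^+ 2).
Proof.
move=> /H2dy_in_L2[[_ iu] [_ iv]].
by rewrite /H2norm_sq RintegralD //; exact: measurable_I0.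
Qed.

Lemma H2norm_sq_kernel I p q : is_kernel_family I p q ->
  H2norm_sq (kernel_fun I p q) = p I.
Proof.
move=> kpq; have [Hk] := kernel_fun_repr kpq.
move=> /(_ _ Hk) /(congr1 (@complex.Re R)) /=.
have [-> _] := averages_kernel_fun kpq => ->.
by apply: eq_Rintegral => x _; rewrite /re_part /im_part /kernel_fun /=; ring.
Qed.

(** The kernel is constant on I with value p I, a positive real equal to its
squared norm. *)
Lemma normalize_kernel_sub I J p q : is_kernel_family I p q ->
  pts (@itv4 R J) `<=` pts (itv4 I) ->
  ComplexField.Normc.normc (at_interval (normalize (kernel_fun I p q)) J) ^+ 2 = p I.
Proof.
move=> kpq JI; rewrite /at_interval /normalize (H2norm_sq_kernel kpq).
case: kpq => _ [tp tq] pI qI _.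
have p0 : 0 < p I by rewrite pI divr_gt0 // addr_gt0 ?expr4_gt0.
have on x : pts (itv4 J) x -> kernel_fun I p q x / (Num.sqrt (p I))%:C =
    (p I / Num.sqrt (p I))%:C.
  move=> /JI Ix; rewrite /kernel_fun (step_at p Ix) (step_at q Ix) qI.
  by rewrite -fmorphV -[_ +i* 0]/((p I)%:C) -rmorphM.
rewrite (@averages_const_on _ (p I / Num.sqrt (p I))); last first.
  by move=> x Jx; rewrite /re_part on.
rewrite (@averages_const_on _ 0); last by move=> x Jx; rewrite /im_part on.
rewrite /= sqr_sqrtr ?addr_ge0 ?sqr_ge0 // expr0n addr0 expr_div_n.
by rewrite sqr_sqrtr ?ltW // expr2 mulfK // gt_eqF.
Qed.

End Kernel.

(** * Summation over all 4-adic intervals *)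

Lemma esum_generation (R : realType) (F : D4 -> R) k : (forall J, 0 <= F J) ->
  (\esum_(J in [set J : D4 | tag J = k]) (F J)%:E = (\sum_(n < 4 ^ k) F (D4_at n))%:E)%E.
Proof.
move=> F0; rewrite (@reindex_esum _ _ _ [set: 'I_(4 ^ k)] _ (@D4_at k)).
  rewrite esum_fset; [|exact: finite_finset|by move=> i _; rewrite lee_fin].
  rewrite -sumEFin -big_enum /= [RHS]fsbig_seq ?enum_uniq //; apply: eq_fsbigl => //.
  by apply/seteqP; split => // i _ /=; rewrite mem_enum.
split.
- by move=> n _.
- by move=> n m _ _ /eqP; rewrite eq_Tagged => /eqP.
- by move=> [k' n] /= kk; case: _ / kk n => n; exists n.
Qed.

Lemma esum_generations_le (R : realType) (F : D4 -> R) (M : R) :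
  (forall J, 0 <= F J) ->
  (forall n, \sum_(k < n) \sum_(i < 4 ^ k) F (@D4_at k i) <= M) ->
  (\esum_(J in [set: D4]) (F J)%:E <= M%:E)%E.
Proof.
move=> F0 FM.
have -> : [set: D4] = \bigcup_(k in [set: nat]) [set J : D4 | tag J = k].
  by apply/seteqP; split => // J _; exists (tag J).
rewrite esum_bigcupT; last 2 first.
- by move=> i j _ _ [J [/= <- <-]].
- by move=> J; rewrite lee_fin.
rewrite -nneseries_esumT => [|k]; last by apply: esum_ge0 => J _; rewrite lee_fin.
apply: lime_le; first by apply: is_cvg_nneseries => k _ _; apply: esum_ge0 => J _; rewrite lee_fin.
apply: nearW => n; under eq_bigr => k _ do rewrite esum_generation //.
by rewrite sumEFin lee_fin big_mkord.
Qed.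

(** * From testing on kernels to the embedding *)

Section Carleson.
Context {R : realType}.
Context (mu : D4 -> R) (mu_ge0 : forall I, 0 <= mu I).
Implicit Types (I J : D4) (u v M : D4 -> R) (f : R -> R[i]).

Definition mass I : \bar R := \esum_(J in @D4_in R (itv4 I)) (mu J)%:E.

Lemma mass_ge0 I : (0 <= mass I)%E.
Proof. by apply: esum_ge0 => J _; rewrite lee_fin. Qed.

(** Only the intervals below I are kept in the testing sum for the kernel of I;
each of them contributes mu_J (4^n + 2)/3, with |I| = 4^-n. *)
Lemma mass_le_testing (c : R) :
  (ereal_sup [set s : \bar R | exists I : D4, exists k : R -> R[i],
     is_repr_kernel I k /\ s = ell2_norm_sq mu (normalize k)] <= c%:E)%E ->
  forall I, (mass I <= (3 * c * len (itv4 I))%:E)%E.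
Proof.
move=> kernel_bound I; have [p [q kpq]] := @exists_kernel_family R I.
have : (ell2_norm_sq mu (normalize (kernel_fun I p q)) <= c%:E)%E.
  apply: le_trans kernel_bound; apply: ereal_sup_ubound.
  by exists I, (kernel_fun I p q); split => //; exact: kernel_fun_repr.
have pI : p I = (4 ^+ tag I + 2) / 3 by case: kpq.
have h4 := @expr4_gt0 R (tag I).
have p0 : 0 < p I by rewrite pI; lra.
move=> kc.
have c0 : 0 <= c.
  rewrite -lee_fin; apply: le_trans kc; apply: esum_ge0 => J _.
  by rewrite lee_fin mulr_ge0 ?sqr_ge0.
have key : (mass I <= (c / p I)%:E)%E.
  apply: ge_ereal_sup => _ [A [finA AI] <-].
  rewrite fsumEFin // lee_fin ler_pdivlMr // mulr_fsuml -lee_fin -fsumEFin //.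
  apply: le_trans kc; apply: esum_ge; exists A; first by split.
  apply: lee_fsum => // J /AI JI.
  by rewrite (normalize_kernel_sub kpq JI).
apply: le_trans key _; rewrite lee_fin ler_pdivrMr // len_itv4 pI.
have -> : 3 * c * (4 ^+ tag I)^-1 * ((4 ^+ tag I + 2) / 3) = c + 2 * c / 4 ^+ tag I.
  by field; rewrite gt_eqF.
by rewrite lerDl divr_ge0 // ?mulr_ge0 // ltW.
Qed.

(** The property of M_I = |I|^-1 sum_(J <= I) mu_J that balancedness provides: M
is a supermartingale with the same drop mu_I/|I| along both pairs of children. *)
Definition is_carleson_density M : Prop := forall I,
  M I - mu I / len (itv4 I) = (M (child_xp I) + M (child_xm I)) / 2 /\
  M I - mu I / len (itv4 I) = (M (child_yp I) + M (child_ym I)) / 2.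

Lemma density_pair K P P' : pts K = pts (itv4 P) `|` pts (itv4 P') ->
  tag P' = tag P -> P <> P' -> len K = len (itv4 P) * 2 ->
  density mu K = ((len (itv4 P) * 2)^-1%:E * (mass P + mass P'))%E.
Proof.
move=> KP PP ne lK; rewrite /density lK (D4_in_split KP PP lK).
congr (_ * _)%E.
rewrite (esumID (@D4_in R (itv4 P))); last by move=> J _; rewrite lee_fin.
have d := D4_in_disjoint (R:=R) (esym PP) ne.
congr (_ + _)%E; congr (esum _ _).
  by apply/seteqP; split=> J /=; [case=> -[]//|move=> h; split=> //; left].
apply/seteqP; split=> J /=; first by case=> -[].
move=> h; split; first by right.
by move=> h'; have : (@D4_in R (itv4 P) `&` @D4_in R (itv4 P')) J by []; rewrite d.
Qed.

(** The Carleson condition makes all densities finite, so the balance equations,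
which live in the extended reals, descend to real numbers. *)
Lemma exists_carleson_density (C : R) : balanced mu ->
  (forall I, (mass I <= (C * len (itv4 I))%:E)%E) ->
  exists2 M, is_carleson_density M & forall I, 0 <= M I <= C.
Proof.
move=> bal massC; exists (fun I => fine (mass I) / len (itv4 I)); last first.
  move=> I; have l0 := @len_itv4_gt0 R I.
  rewrite divr_ge0 ?ler_pdivrMr //=; last exact: ltW.
    rewrite -lee_fin fineK // ge0_fin_numE ?mass_ge0 //.
    exact: le_lt_trans (massC I) (ltry _).
  exact/fine_ge0/mass_ge0.
have massE I : mass I = (fine (mass I))%:E.
  rewrite fineK // ge0_fin_numE ?mass_ge0 //.
  exact: le_lt_trans (massC I) (ltry _).
have half I j j' K : pts K = pts (itv4 (D4_child I j)) `|` pts (itv4 (D4_child I j')) ->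
    j != j' -> len K = len (itv4 I) / 2 ->
    density mu K = ((fine (mass (D4_child I j')) / len (itv4 (D4_child I j')) +
                     fine (mass (D4_child I j)) / len (itv4 (D4_child I j))) / 2)%:E.
  move=> KI jj lK; rewrite (density_pair KI) //.
  - rewrite (massE (D4_child I j)) (massE (D4_child I j')) -EFinD -EFinM.
    rewrite !len_child; congr EFin.
    by have := @len_itv4_gt0 R I => h; field; rewrite gt_eqF.
  - move/eqP; rewrite eq_Tagged /= => /eqP [] /(congr1 (subn^~ (4 * tagged I)%N)).
    by rewrite !addKn => /val_inj /eqP; rewrite (negbTE jj).
  - by rewrite lK len_child; field.
move=> I; have [_ ey ex] := @pts_quarters R I.
have [] := bal I; rewrite (half I _ _ _ ex) //; last by rewrite len_rhalf.
rewrite (half I _ _ _ ey) //; last by rewrite len_lhalf.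
rewrite /density -/(mass I) (massE I) -EFinM -EFinB => -[xy] [yI].
by rewrite -xy in yI *; split; rewrite -?xy yI mulrC.
Qed.

(** The Bellman functional |f|^2 exp(-M/C) at I, weighted by |I| so that the sum
over a generation is an integral over I0. *)
Definition damped (C : R) M u v J : R :=
  len (itv4 J) * (expR (- (M J / C)) * (u J ^+ 2 + v J ^+ 2)).

(** By [bellman_inequality] the sum over the children is at least
|I| |f_I|^2 exp(-m), where m is the common mean of M/C over each pair of
children. Since m = M_I/C - mu_I/(C|I|), this is at least
|I| |f_I|^2 exp(-M_I/C) (1 + mu_I/(C|I|)), and exp(-M_I/C) >= 1/e. *)
Lemma carleson_step (C : R) M u v I : 0 < C -> is_carleson_density M ->
  (forall J, 0 <= M J <= C) -> conformal u v ->
  damped C M u v I + mu I * (u I ^+ 2 + v I ^+ 2) / (C * expR 1) <=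
  \sum_(j < 4) damped C M u v (D4_child I j).
Proof.
move=> C0 dM MC cuv; set B := damped C M u v.
set F := u I ^+ 2 + v I ^+ 2; have F0 : 0 <= F by rewrite addr_ge0 ?sqr_ge0.
have l0 := @len_itv4_gt0 R I; set l := len (itv4 I) in l0.
pose m := M I / C - mu I / l / C.
have [dx dy] := dM I.
pose x := M (child_xp I) / C - m; pose y := M (child_yp I) / C - m.
have xpE : M (child_xp I) / C = m + x by rewrite /x; ring.
have ypE : M (child_yp I) / C = m + y by rewrite /y; ring.
have mE : m = (M I - mu I / len (itv4 I)) / C by rewrite /m mulrBl.
have xmE : M (child_xm I) / C = m - x.
  by rewrite /x mE dx; field; rewrite gt_eqF.
have ymE : M (child_ym I) / C = m - y.
  by rewrite /y mE dy; field; rewrite gt_eqF.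
have := bellman_inequality (u I) (v I) (incr_x u I) (incr_y u I) m x y.
rewrite -/F => bell.
have sumE : \sum_(j < 4) B (D4_child I j) = l / 4 *
  (expR (- (m + x)) * ((u I + incr_x u I) ^+ 2 + (v I - incr_y u I) ^+ 2) +
  expR (- (m - x)) * ((u I - incr_x u I) ^+ 2 + (v I + incr_y u I) ^+ 2) +
  expR (- (m + y)) * ((u I + incr_y u I) ^+ 2 + (v I + incr_x u I) ^+ 2) +
  expR (- (m - y)) * ((u I - incr_y u I) ^+ 2 + (v I - incr_x u I) ^+ 2)).
  rewrite sum_children /B /damped xpE xmE ypE ymE.
  have [-> ->] := conformal_child I (@Ordinal 4 0 isT) cuv.
  have [-> ->] := conformal_child I (@Ordinal 4 1 isT) cuv.
  have [-> ->] := conformal_child I (@Ordinal 4 2 isT) cuv.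
  have [-> ->] := conformal_child I (@Ordinal 4 3 isT) cuv.
  by rewrite !len_child -/l /wx /wy /=; ring.
have E0 : (expR 1)^-1 <= expR (- (M I / C)).
  have /andP[_ MI] := MC I.
  by rewrite -expRN ler_expR lerN2 ler_pdivrMr // mul1r.
have t0 : 0 <= mu I / l / C by rewrite !divr_ge0 // ltW.
have E1 : expR (- (M I / C)) * (1 + mu I / l / C) <= expR (- m).
  rewrite (_ : - m = - (M I / C) + mu I / l / C); last by rewrite /m; ring.
  by rewrite expRD ler_wpM2l ?expR_ge0 // expR_ge1Dx.
rewrite sumE.
have -> : B I + mu I * F / (C * expR 1) =
    l * F * (expR (- (M I / C)) + (expR 1)^-1 * (mu I / l / C)).
  rewrite /B /damped -/l -/F; field.
  by rewrite !gt_eqF // expR_gt0.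
apply: (@le_trans _ _ (l * F * expR (- m))).
  apply: ler_wpM2l; first by rewrite mulr_ge0 // ltW.
  apply: le_trans E1; rewrite mulrDr mulr1 lerD2l.
  exact: ler_wpM2r.
by have := ler_wpM2l (ltW l0) bell; lra.
Qed.

Lemma carleson_partial_sum (C : R) M u v n : 0 < C -> is_carleson_density M ->
  (forall J, 0 <= M J <= C) -> conformal u v ->
  \sum_(k < n) \sum_(i < 4 ^ k)
     mu (@D4_at k i) * (u (D4_at i) ^+ 2 + v (D4_at i) ^+ 2) <=
  C * expR 1 *
    \sum_(i < 4 ^ n) len (itv4 (@D4_at n i)) * (u (D4_at i) ^+ 2 + v (D4_at i) ^+ 2).
Proof.
move=> C0 dM MC cuv.
pose B := damped C M u v.
have Ce : 0 < C * expR 1 by rewrite mulr_gt0 // expR_gt0.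
have n0 J : 0 <= u J ^+ 2 + v J ^+ 2 by rewrite addr_ge0 ?sqr_ge0.
have B0 J : 0 <= B J.
  by rewrite !mulr_ge0 ?expR_ge0 //; apply/ltW/len_itv4_gt0.
apply: (@le_trans _ _ (C * expR 1 * \sum_(i < 4 ^ n) B (D4_at i))); last first.
  apply: ler_wpM2l; first exact: ltW.
  apply: ler_sum => i _; apply: ler_wpM2l; first exact/ltW/len_itv4_gt0.
  have /andP[M0 _] := MC (D4_at i).
  by rewrite ler_piMl // -expR0 ler_expR oppr_le0 divr_ge0 // ltW.
elim: n => [|n IH].
  by rewrite big_ord0 mulr_ge0 ?sumr_ge0 // ltW.
rewrite big_ord_recr /= (sum_generationS n B).
apply: le_trans (lerD IH (lexx _)) _.
rewrite -ler_pdivrMl // mulrDr mulrA mulVf ?gt_eqF // mul1r mulr_sumr -big_split /=.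
apply: ler_sum => i _.
by have := carleson_step (D4_at i) C0 dM MC cuv; rewrite -/B [_ / _]mulrC.
Qed.

Lemma H2dy_energy_le f n : H2dy f ->
  \sum_(i < 4 ^ n) len (itv4 (@D4_at n i)) *
    (averages (re_part f) (D4_at i) ^+ 2 + averages (im_part f) (D4_at i) ^+ 2) <=
  H2norm_sq f.
Proof.
move=> Hf; have [Lu Lv] := H2dy_in_L2 Hf; rewrite (H2norm_sqE Hf).
under eq_bigr => i _ do rewrite mulrDr.
by rewrite big_split /= lerD // averages_energy_le.
Qed.

(** The dyadic Carleson embedding theorem for balanced sequences with the constant
e, which balancedness and conformality put in place of the constant 4 of the
general dyadic theorem. *)
Lemma carleson_embedding (C : R) f : balanced mu ->
  (forall I, (mass I <= (C * len (itv4 I))%:E)%E) -> H2dy f ->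
  (\esum_(I in [set: D4])
      (mu I * (averages (re_part f) I ^+ 2 + averages (im_part f) I ^+ 2))%:E
   <= (C * expR 1 * H2norm_sq f)%:E)%E.
Proof.
move=> bal massC Hf; have [M dM MC] := exists_carleson_density bal massC.
have F0 J : 0 <= averages (re_part f) J ^+ 2 + averages (im_part f) J ^+ 2.
  by rewrite addr_ge0 ?sqr_ge0.
have : 0 <= C by have /andP[] := MC D4_root; exact: le_trans.
rewrite le_eqVlt => /orP[/eqP C0|C0].
  (* C = 0: the density vanishes identically, hence so do its drops mu_I/|I|. *)
  rewrite -C0 !mul0r esum1 // => I _; suff -> : mu I = 0 by rewrite mul0r.
  have l0 := @len_itv4_gt0 R I.
  have M0 J : M J = 0 by apply/eqP; rewrite eq_le andbC; have := MC J; rewrite -C0.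
  have [+ _] := dM I; rewrite !M0 addr0 mul0r sub0r => /eqP.
  by rewrite oppr_eq0 mulf_eq0 invr_eq0 (gt_eqF l0) orbF => /eqP.
apply: esum_generations_le => [J|n]; first by rewrite mulr_ge0.
apply: le_trans (carleson_partial_sum n C0 dM MC (H2dy_conformal Hf)) _.
by apply: ler_wpM2l; [rewrite mulr_ge0 ?expR_ge0 // ltW|exact: H2dy_energy_le].
Qed.

End Carleson.

Theorem theorem6 (R : realType) (mu : D4 -> R) (Imu : R)
    (mu_ge0 : forall I : D4, 0 <= mu I)
    (mu_balanced : balanced mu)
    (kernel_bound :
      (ereal_sup [set s : \bar R | exists I : D4, exists k : R -> R[i],
         is_repr_kernel I k /\ s = ell2_norm_sq mu (normalize k)]
       <= Imu%:E)%E) :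
  forall f : R -> R[i], H2dy f ->
    ((\esum_(I in [set: D4])
        (mu I * (averages (re_part f) I ^+ 2 + averages (im_part f) I ^+ 2))%:E)
     <= (3 * expR 1 * Imu * H2norm_sq f)%:E)%E.
Proof.
move=> f Hf.
have := carleson_embedding mu_ge0 mu_balanced (mass_le_testing mu_ge0 kernel_bound) Hf.
by rewrite [3 * expR 1 * Imu]mulrAC.
Qed.
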